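(* Let $d>k\geq 1$ be integers, let $\varepsilon\in(0,1)$, and let $A\in\mathbb{R}^{d\times d}$ be symmetric positive semidefinite with $\lambda_k>\lambda_{k+1}$. Let $X_0\in\mathrm{St}(d,k)$ satisfy $\cos\theta_k(U_k,X_0)>0$, and let $\beta>0$ satisfy $\lambda_k>2\sqrt{\beta}\geq\lambda_{k+1}$. Consider the ANPM iterates $(X_t)_{t\geq0}$ with momentum $\beta$ and perturbations $(\Xi_t)_{t\geq0}\subset\mathbb{R}^{d\times k}$ satisfying, for all $t\geq 0$, $$\|U_{-k}^\top \Xi_t\|_2\leq c(\lambda_k-2\sqrt{\beta})\varepsilon,\qquad \|U_k^\top\Xi_t\|_2\leq c(\lambda_k-2\sqrt{\beta})\cos\theta_k(U_k,X_t),$$ where $c:=1/32$. Let $h_0:=\tan\theta_k(U_k,X_0)$ and $$T:=\frac{\log(2h_0/\varepsilon)}{-\log\left(1-\frac12\sqrt{\frac{\lambda_k-2\sqrt{\beta}}{\lambda_k}}\right)}.$$ Then for every integer $t\geq T$, $\sin\theta_k(U_k,X_t)\leq\varepsilon$. (In particular $T=O\big(\sqrt{\lambda_k/(\lambda_k-2\sqrt\beta)}\,\log(\tan\theta_k(U_k,X_0)/\varepsilon)\big)$.)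
   Context: $A$ has eigenvalues $\lambda_1\geq\dots\geq\lambda_d\geq0$ with corresponding orthonormal eigenvectors $u_1,\dots,u_d$; $U_k:=[u_1,\dots,u_k]$, $U_{-k}:=[u_{k+1},\dots,u_d]$. $\mathrm{St}(d,k):=\{X\in\mathbb{R}^{d\times k}:X^\top X=I_k\}$. For $Y\in\mathbb{R}^{d\times k}$, $\mathrm{QR}(Y)$ is the pair $(X,R)$ with $Y=XR$, $X\in\mathrm{St}(d,k)$, $R\in\mathbb{R}^{k\times k}$ upper triangular with nonnegative diagonal (unique, with $R$ invertible, when $Y$ has full column rank). For $U,X\in\mathrm{St}(d,k)$, the $k$-th principal angle is $\theta_k(U,X):=\arccos\sigma_{\min}(U^\top X)\in[0,\pi/2]$. The Accelerated Noisy Power Method (ANPM) with momentum $\beta>0$ and perturbations $(\Xi_t)_{t\geq0}$ is: given $X_0\in\mathrm{St}(d,k)$, $(X_1,R_1)=\mathrm{QR}(\tfrac12 AX_0+\Xi_0)$, and for $t\geq1$, $Y_{t+1}=AX_t-\beta X_{t-1}R_t^{-1}+\Xi_t$, $(X_{t+1},R_{t+1})=\mathrm{QR}(Y_{t+1})$. The perturbation $\Xi_t$ may depend on the iterates. *)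

(* Defs.v *)
From HB Require Import structures.
From mathcomp Require Import all_boot all_order all_algebra.
From mathcomp Require Import all_classical all_reals all_analysis.
Set Implicit Arguments. Unset Strict Implicit. Unset Printing Implicit Defensive.
Import Order.TTheory GRing.Theory Num.Theory.
Local Open Scope classical_set_scope.
Local Open Scope ring_scope.

Section Defs.
Variable R : realType.

Definition vnorm (n : nat) (x : 'cV[R]_n) : R := Num.sqrt (\sum_i x i 0 ^+ 2).

Definition opnorm (p q : nat) (M : 'M[R]_(p, q)) : R :=
  sup [set vnorm (M *m x) | x in [set x : 'cV[R]_q | vnorm x = 1]].

Definition sigma_min (n : nat) (M : 'M[R]_n) : R :=
  inf [set vnorm (M *m x) | x in [set x : 'cV[R]_n | vnorm x = 1]].

Definition stiefel (d k : nat) (X : 'M[R]_(d, k)) : Prop := X^T *m X = 1%:M.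

Definition theta_k (d k : nat) (U X : 'M[R]_(d, k)) : R :=
  acos (sigma_min (U^T *m X)).

Definition is_QR (d k : nat) (Y X : 'M[R]_(d, k)) (Rm : 'M[R]_k) : Prop :=
  [/\ Y = X *m Rm, stiefel X,
      (forall i j : 'I_k, (j < i)%N -> Rm i j = 0) &
      (forall i : 'I_k, 0 <= Rm i i)].

End Defs.

(* Main.v *)
Require Import Defs.
From HB Require Import structures.
From mathcomp Require Import all_boot all_order all_algebra.
From mathcomp Require Import all_classical all_reals all_analysis.
From mathcomp Require Import ring lra.
Import Order.TTheory GRing.Theory Num.Theory.
Local Open Scope ring_scope.
Set Implicit Arguments. Unset Strict Implicit. Unset Printing Implicit Defensive.

(* Fix a vector v_0 and set v_{s+1} = R_{s+1} v_s, so that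
   p_s = U_k^T X_s v_s and q_s = U_{-k}^T X_s v_s satisfy linear three-term
   recurrences free of the matrices R_s^{-1}; as the R_s are invertible, v_t is
   an arbitrary vector, and it suffices to show |q_t| <= eps |p_t|.
   Put b = sqrt beta, D = (lambda_k - 2 b) / b, P_s = |p_s| / b^s and
   Q_s = |q_s| / b^s.  Since |U_k^T Xi_s v_s| <= (b D / 32) |p_s|, the sequence P
   grows at least like c, where c_{s+2} = (2 + 15 D / 16) c_{s+1} - c_s.
   Since the eigenvalues of the complementary block lie in [0, 2 b], Duhamel's
   formula and the Chebyshev bounds |T_n| <= 1, |U_n| <= n + 1 on [-1, 1] give
     Q_t <= Q_0 + sum_{s < t} (t - s) (D eps / 32) (P_s + Q_s).
   A discrete Gronwall argument yields Q_t / P_t <= eps / 14 + h_0 z^t / c_t for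
   (z - 1)^2 >= D z / 32, and c_t >= (7 / 13) (z / rho)^t for the rate rho of the
   theorem, hence Q_t / P_t <= eps / 14 + (13 / 7) h_0 rho^t <= eps once
   2 h_0 rho^t <= eps. *)

(** * Choice of growth rates *)

(* [z] is the noise-amplified growth rate, [y = z / rho], and
   [7 y^n + 6 eta^n] will be a subsolution of the recurrence for [c].
   The hypothesis on [D] says that [r = sqrt (D / (2 + D))]. *)
Lemma rate_choice (R : realFieldType) (D r : R) :
  0 < r -> r < 1 -> D * (1 - r ^+ 2) = 2 * r ^+ 2 ->
  exists z y eta : R, [/\ y * (1 - 2^-1 * r) = z,
    1 <= z /\ D / 32 * z <= (z - 1) ^+ 2,
    1 <= y /\ (y - 1) ^+ 2 <= 15 / 16 * D * y,
    0 < eta /\ (eta - 1) ^+ 2 <= 15 / 16 * D * eta &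
    7 * y + 6 * eta <= 13 * (1 + 15 / 32 * D)].
Proof.
move=> r0 r1 hD.
have r2 : 0 < 1 - r ^+ 2 by nra.
have D2 : 2 * r ^+ 2 <= D by nra.
have rho0 : 0 < 1 - 2^-1 * r by lra.
have [hr|hr] := lerP r (3 / 5).
  (* For small [r], [D] is close to [2 * r ^+ 2], so the condition on [z] needs a slope of at least
     1/4 in [r]. The slope 7/20 leaves room up to [r = 3/5], and [y - 1] then has slope about 7/20 +
     1/2 = 17/20. *)
  exists (1 + 7 / 20 * r), ((1 + 7 / 20 * r) / (1 - 2^-1 * r)), (1 - r).
  set y := _ / _.
  have hy : y * (1 - 2^-1 * r) = 1 + 7 / 20 * r by rewrite /y mulfVK // gt_eqF.
  have y1 : 1 <= y by nra.
  split=> //.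
  - split; first lra.
    rewrite -(ler_pM2r r2).
    have -> : D / 32 * (1 + 7 / 20 * r) * (1 - r ^+ 2) =
      D * (1 - r ^+ 2) * (1 + 7 / 20 * r) / 32 by ring.
    rewrite hD; have : 0 <= r ^+ 2 * (49 / 400 * (1 - r ^+ 2) - (1 + 7 / 20 * r) / 16).
      by apply: mulr_ge0; nra.
    lra.
  - split=> //.
    have hy1 : (y - 1) * (1 - 2^-1 * r) = 17 / 20 * r by lra.
    have hy2 : y - 1 <= 17 / 14 * r by nra.
    nra.
  - by split; nra.
  - have hy1 : (y - 1) * (1 - 2^-1 * r) = 17 / 20 * r by lra.
    suff : 7 * (y - 1) <= 6 * r + 195 / 32 * D by lra.
    rewrite -(ler_pM2r rho0).
    have -> : 7 * (y - 1) * (1 - 2^-1 * r) = 7 * (17 / 20 * r) by rewrite -hy1 mulrA.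
    have : 0 <= r * (6 * (1 - 2^-1 * r) + 195 / 16 * r * (1 - 2^-1 * r) - 119 / 20).
      by apply: mulr_ge0; nra.
    nra.
(* As [r] tends to 1, [D] is unbounded, so [z] is taken linear in [D]. The slope 37/200 works
   because [r > 3/5] forces [D > 9/8]. *)
exists (1 + 37 / 200 * D), ((1 + 37 / 200 * D) / (1 - 2^-1 * r)), 1.
set y := _ / _.
have hy : y * (1 - 2^-1 * r) = 1 + 37 / 200 * D by rewrite /y mulfVK // gt_eqF.
have D0 : 0 < D by nra.
have y1 : 1 <= y by nra.
(* The slope 195/224 is the largest that the last condition allows with [eta = 1]; it is below
   15/16. *)
have yD : y <= 1 + 195 / 224 * D.
  rewrite -(ler_pM2r rho0) hy -(ler_pM2r r2).
  have -> : (1 + 37 / 200 * D) * (1 - r ^+ 2) = 1 - r ^+ 2 + 37 / 200 * (D * (1 - r ^+ 2)) by ring.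
  have -> : (1 + 195 / 224 * D) * (1 - 2^-1 * r) * (1 - r ^+ 2) =
    (1 - r ^+ 2 + 195 / 224 * (D * (1 - r ^+ 2))) * (1 - 2^-1 * r) by ring.
  rewrite hD.
  have : 0 <= r * (2742 / 1000 * r - 1 - 742 / 1000 * r ^+ 2) by apply: mulr_ge0; nra.
  nra.
split=> //.
- split; first lra.
  suff : (1 + 37 / 200 * D) / 32 <= (37 / 200) ^+ 2 * D by nra.
  nra.
- by split=> //; nra.
- by split; nra.
- lra.
Qed.

(** * Chebyshev sequences and Duhamel's formula *)

(* [lucas x (x / 2) n] and [lucas x x n] are the Chebyshev values
   [T_n (x / 2)] and [U_n (x / 2)]. *)
Fixpoint lucas {R : pzRingType} (l a : R) (n : nat) : R :=
  match n with
  | 0 => 1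
  | S n' => match n' with 0 => a | S n'' => l * lucas l a n' - lucas l a n'' end
  end.

Lemma lucasSS (R : pzRingType) (l a : R) n :
  lucas l a n.+2 = l * lucas l a n.+1 - lucas l a n.
Proof. by []. Qed.

Lemma lucas_gt0 (R : realFieldType) (l a : R) : 2 <= l -> 1 <= a ->
  forall n, 0 < lucas l a n /\ lucas l a n <= lucas l a n.+1.
Proof.
move=> hl ha; elim=> [|n [IH1 IH2]]; first by rewrite /= ltr01.
split; first exact: lt_le_trans IH2.
rewrite lucasSS; nra.
Qed.

(** For [|x| < 2], completing the square in a conserved quadratic form gives
    [(4 - x^2) T_n^2 <= 4 - x^2]. At [|x| = 2] this form degenerates, but there
    [T_n = (x / 2)^n]. *)
Lemma cheb1_le1 (R : realFieldType) (x : R) n : `|x| <= 2 ->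
  `|lucas x (x / 2) n| <= 1.
Proof.
move=> hx.
(* [T_{m+1}^2 + T_m^2 - x T_m T_{m+1}] does not depend on [m]. *)
have inv m : lucas x (x / 2) m.+1 ^+ 2 + lucas x (x / 2) m ^+ 2
    - x * lucas x (x / 2) m * lucas x (x / 2) m.+1 = 1 - x ^+ 2 / 4.
  elim: m => [|m IH]; first by rewrite /=; field.
  by rewrite -IH lucasSS; ring.
have [x2|x2] := eqVneq (`|x|) 2; last first.
  have x4 : 0 < 4 - x ^+ 2.
    have : `|x| < 2 by rewrite lt_neqAle x2 hx.
    by rewrite ltr_norml => /andP[? ?]; nra.
  rewrite -(@ler_pXn2r _ 2) ?nnegrE // expr1n real_normK ?num_real //.
  have := inv n; set a := lucas _ _ n; set b := lucas _ _ _ => h.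
  suff : (4 - x ^+ 2) * (a ^+ 2) <= (4 - x ^+ 2) * 1 by rewrite ler_pM2l.
  have : 0 <= (2 * b - x * a) ^+ 2 by exact: sqr_ge0.
  lra.
suff -> : lucas x (x / 2) n = (x / 2) ^+ n.
  by rewrite normrX normrM x2 normfV ger0_norm ?ler0n // divff ?expr1n //.
have x4 : x ^+ 2 = 4 by rewrite -real_normK ?num_real // x2; ring.
suff : lucas x (x / 2) n = (x / 2) ^+ n /\ lucas x (x / 2) n.+1 = (x / 2) ^+ n.+1
  by case.
elim: n => [|n [IH1 IH2]]; first by rewrite expr0 expr1.
split=> //; rewrite lucasSS IH1 IH2 !exprS.
set w := _ ^+ n.
have -> : x * (x / 2 * w) - w = (x ^+ 2 / 2 - 1) * w by ring.
have -> : x / 2 * (x / 2 * w) = (x ^+ 2 / 4) * w by field.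
by rewrite x4; field.
Qed.

(** Since [U_(m+1) = (x / 2) U_m + T_(m+1)], each step adds at most 1 in absolute value. *)
Lemma cheb2_le (R : realFieldType) (x : R) n : `|x| <= 2 ->
  `|lucas x x n| <= n.+1%:R.
Proof.
move=> hx.
have rel m : lucas x x m.+1 = x / 2 * lucas x x m + lucas x (x / 2) m.+1.
  suff : lucas x x m.+1 = x / 2 * lucas x x m + lucas x (x / 2) m.+1 /\
    lucas x x m.+2 = x / 2 * lucas x x m.+1 + lucas x (x / 2) m.+2 by case.
  elim: m => [|m [IH1 IH2]]; first by split; rewrite /=; field.
  split=> //.
  have t1 : lucas x (x / 2) m.+1 = lucas x x m.+1 - x / 2 * lucas x x m.
    by rewrite IH1; ring.
  have t2 : lucas x (x / 2) m.+2 = lucas x x m.+2 - x / 2 * lucas x x m.+1.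
    by rewrite IH2; ring.
  by rewrite (lucasSS x x m.+1) (lucasSS x (x / 2) m.+1) t2 t1 (lucasSS x x m); field.
elim: n => [|n IH]; first by rewrite /= normr1.
rewrite rel -(natr1 n.+1); apply: le_trans (ler_normD _ _) _.
apply: lerD; last exact: cheb1_le1.
apply: le_trans IH; rewrite normrM ler_piMl // normrM normfV.
by rewrite [X in _ / X]ger0_norm ?ler0n // ler_pdivrMr ?mul1r.
Qed.

(** Variation of constants: the impulse [f s] enters at time [s + 1] and then propagates as [U]. The
    separate [a] accounts for the first step, which follows its own rule. *)
Lemma lucas_duhamel (R : comNzRingType) (x a : R) (q f : nat -> R) :
  q 1%N = a * q 0%N + f 0%N ->
  (forall n, q n.+2 = x * q n.+1 - q n + f n.+1) ->
  forall n, q n = lucas x a n * q 0%N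
    + \sum_(0 <= s < n) lucas x x (n - s.+1) * f s.
Proof.
move=> q1 qS n.
suff : q n = lucas x a n * q 0%N
    + \sum_(0 <= s < n) lucas x x (n - s.+1) * f s /\
  q n.+1 = lucas x a n.+1 * q 0%N
    + \sum_(0 <= s < n.+1) lucas x x (n.+1 - s.+1) * f s by case.
elim: n => [|n [IH1 IH2]].
  by rewrite big_geq // big_nat1 /= q1; split; ring.
split=> //; rewrite qS IH1 IH2 !big_nat_recr //= !subnn !subSnn /=.
have -> : \sum_(0 <= i < n) lucas x x (n.+2 - i.+1) * f i =
  x * (\sum_(0 <= i < n) lucas x x (n.+1 - i.+1) * f i) -
  \sum_(0 <= i < n) lucas x x (n - i.+1) * f i.
  rewrite mulr_sumr -sumrB; apply: eq_big_nat => i /andP[_ hi].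
  have -> : (n.+2 - i.+1 = (n - i.+1).+2)%N by rewrite -!subSn // leqW.
  have -> : (n.+1 - i.+1 = (n - i.+1).+1)%N by rewrite -subSn.
  by rewrite lucasSS; ring.
by rewrite -/(lucas x a n.+1); ring.
Qed.

(** * Comparison principles and a discrete Gronwall bound *)

(** The discrete Wronskian [P (n+1) e n - e (n+1) P n] never decreases, so [P / e] is nondecreasing.
    The cross-multiplied form tolerates zeros of [P]. *)
Lemma supersolution_ratio_le (R : realFieldType) (l : R) (P e : nat -> R) :
  (forall n, 0 <= P n) -> (forall n, 0 < e n) ->
  e 1%N * P 0%N <= P 1%N * e 0%N ->
  (forall n, l * P n.+1 - P n <= P n.+2) ->
  (forall n, e n.+2 <= l * e n.+1 - e n) ->
  forall s t, (s <= t)%N -> e t * P s <= P t * e s.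
Proof.
move=> P0 e0 h1 hP he.
have step n : e n.+1 * P n <= P n.+1 * e n.
  elim: n => [//|n IH].
  have := ler_wpM2r (P0 n.+1) (he n).
  have := ler_wpM2r (ltW (e0 n.+1)) (hP n).
  lra.
move=> s; elim=> [|t IH]; first by rewrite leqn0 => /eqP ->; rewrite mulrC.
rewrite leq_eqVlt => /orP[/eqP <-|/IH {}IH]; first by rewrite mulrC.
rewrite -(ler_pM2r (e0 t)).
have := ler_wpM2r (ltW (e0 t.+1)) IH.
have := ler_wpM2r (ltW (e0 s)) (step t).
lra.
Qed.

(** The condition on [y] reads [y^2 <= (2 + 15/16 D) y - 1], so [y^n] is a subsolution, and likewise
    [eta^n]. As [y] may exceed [1 + 15/32 D], [eta^n] is mixed in to correct the initial ratio, at
    the price of the factor 13/7. *)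
Lemma lucas_exp_lower (R : realFieldType) (D y eta : R) :
  0 <= D -> 1 <= y -> (y - 1) ^+ 2 <= 15 / 16 * D * y ->
  0 < eta -> (eta - 1) ^+ 2 <= 15 / 16 * D * eta ->
  7 * y + 6 * eta <= 13 * (1 + 15 / 32 * D) ->
  forall n, 7 * y ^+ n <= 13 * lucas (2 + 15 / 16 * D) (1 + 15 / 32 * D) n.
Proof.
move=> D0 y1 hy eta0 heta h1 n.
set c := lucas _ _.
have c0 m : 0 < c m by apply: (lucas_gt0 _ _ m).1; lra.
have yn m : 0 < y ^+ m by apply: exprn_gt0; lra.
have en m : 0 < eta ^+ m by apply: exprn_gt0.
pose e m := 7 * y ^+ m + 6 * eta ^+ m.
have : e n * c 0%N <= c n * e 0%N.
  apply: (@supersolution_ratio_le _ (2 + 15 / 16 * D)) => //.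
  - by move=> m; exact: ltW.
  - by move=> m; have := yn m; have := en m; rewrite /e; lra.
  - by rewrite /e !expr1 !expr0 /c /=; lra.
  - move=> m; rewrite /e !exprS.
    have := ler_wpM2l (ltW (yn m)) hy.
    have := ler_wpM2l (ltW (en m)) heta.
    set Y := y ^+ m; set E := eta ^+ m.
    lra.
rewrite /e !expr0 (_ : c 0%N = 1) //.
have := en n; lra.
Qed.

(** Strong induction: the earlier bounds on [Q s] and the monotone ratio [P / c] turn the sum into a
    multiple of [P n], so a supersolution of a scalar Volterra equation suffices. *)
Lemma gronwall_lucas (R : realFieldType) (D eps h z : R) (P Q : nat -> R) :
  0 < D -> 0 < eps -> eps <= 1 -> 0 <= h ->
  1 <= z -> D / 32 * z <= (z - 1) ^+ 2 ->
  (forall n, 0 <= P n) -> (forall n, 0 <= Q n) ->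
  (1 + 15 / 32 * D) * P 0%N <= P 1%N ->
  (forall n, (2 + 15 / 16 * D) * P n.+1 - P n <= P n.+2) ->
  Q 0%N <= h * P 0%N ->
  (forall n, Q n <= Q 0%N + \sum_(0 <= s < n)
     (n - s)%:R * (D / 32 * eps * (P s + Q s))) ->
  let c := lucas (2 + 15 / 16 * D) (1 + 15 / 32 * D) in
  forall n, Q n * c n <= (eps / 14 * c n + h * z ^+ n) * P n.
Proof.
move=> D0 e0 e1 h0 z1 hz P0 Q0 hP1 hP hQ0 hQ c.
have c0 m : 0 < c m by apply: (lucas_gt0 _ _ m).1; lra.
have c00 : c 0%N = 1 by [].
have c01 : c 1%N = 1 + 15 / 32 * D by [].
have zn m : 0 < z ^+ m by apply: exprn_gt0; lra.
(* This pays for the first increment of [h * z ^+ m]; [z = 1] is excluded by [D > 0]. *)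
have hz1 : D / 32 <= z - 1.
  have [z2|z2] : z = 1 \/ 1 < z by move: z1; rewrite le_eqVlt => /orP[/eqP|]; auto.
    by move: hz; rewrite z2; lra.
  by nra.
have D32e : 0 <= D / 32 * eps by nra.
have ed : eps * D <= D by nra.
have PP s t : (s <= t)%N -> c t * P s <= P t * c s.
  apply: (@supersolution_ratio_le _ (2 + 15 / 16 * D)) => //.
  by rewrite c01 c00 mulr1.
(* [w] is a supersolution of [w n = h + sum_(s < n) (n - s) D eps / 32 (c s + w s)]. *)
pose w m := eps / 14 * c m + h * z ^+ m.
pose phi m := D / 32 * eps * (c m + w m).
(* The base case fixes the constant 14: [(1 + 1/14) / 32 = (15/32) / 14]. Afterwards [phi] is
   dominated by the second difference of [w]. *)
have dw m : \sum_(0 <= s < m.+1) phi s <= w m.+1 - w m.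
  elim: m => [|m IH].
    rewrite big_nat1 /phi /w !expr0 expr1 c01 c00.
    have := ler_wpM2l h0 hz1.
    have := ler_wpM2r h0 ed.
    have := ler_wpM2r (ltW e0) ed.
    nra.
  rewrite big_nat_recr //=.
  suff : phi m.+1 <= w m.+2 - 2 * w m.+1 + w m by move: IH; lra.
  rewrite /phi /w [c m.+2]lucasSS -/c !exprS.
  have : 0 <= h * z ^+ m * ((z - 1) ^+ 2 - D / 32 * z).
    by rewrite mulr_ge0 ?subr_ge0 // mulr_ge0 // ltW.
  have : 0 <= h * (z * z ^+ m) * (D - eps * D).
    by rewrite mulr_ge0 ?subr_ge0 // mulr_ge0 // mulr_ge0 // ?(ltW (zn _)); lra.
  have := ler_wpM2r (mulr_ge0 (ltW e0) (ltW (c0 m.+1))) ed.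
  have : 0 <= D * (eps * c m.+1).
    by rewrite !mulr_ge0 // ltW.
  set Z := z ^+ m; set C1 := c m.+1; set C := c m.
  lra.
have Phi m : h + \sum_(0 <= s < m) (m - s)%:R * phi s <= w m.
  elim: m => [|m IH].
    by rewrite big_geq // /w expr0 mulr1 addr0 c00; lra.
  have -> : \sum_(0 <= s < m.+1) (m.+1 - s)%:R * phi s =
    \sum_(0 <= s < m) (m - s)%:R * phi s + \sum_(0 <= s < m.+1) phi s.
    rewrite big_nat_recr //= [X in _ = _ + X]big_nat_recr //= subSnn mul1r addrA.
    congr (_ + _); rewrite -big_split /=; apply: eq_big_nat => i /andP[_ hi].
    by rewrite (subSn (ltnW hi)) -(natr1 (m - i)) mulrDl mul1r.
  have := dw m; lra.
elim/ltn_ind => n IH.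
apply: le_trans (ler_wpM2r (P0 n) (Phi n)).
apply: le_trans (ler_wpM2r (ltW (c0 n)) (hQ n)) _.
rewrite !mulrDl; apply: lerD.
  apply: le_trans (ler_wpM2r (ltW (c0 n)) hQ0) _.
  have := ler_wpM2l h0 (PP 0%N n (leq0n n)).
  by rewrite c00 mulr1; lra.
rewrite !mulr_suml; apply: ler_sum_nat => s /andP[_ hs].
have -> : (n - s)%:R * (D / 32 * eps * (P s + Q s)) * c n =
  (n - s)%:R * (D / 32 * eps) * ((P s + Q s) * c n) by ring.
have -> : (n - s)%:R * phi s * P n =
  (n - s)%:R * (D / 32 * eps) * ((c s + w s) * P n) by rewrite /phi; ring.
apply: ler_wpM2l; first by rewrite mulr_ge0.
rewrite mulrDl [leRHS]mulrDl.
have h1 := PP s n (ltnW hs).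
have h2 := IH s hs; rewrite -/(w s) in h2.
have w0 : 0 <= w s by rewrite /w addr_ge0 // mulr_ge0 // ltW // ?divr_gt0.
apply: lerD; first by lra.
rewrite -(ler_pM2r (c0 s)).
have := ler_wpM2l w0 h1.
have := ler_wpM2r (ltW (c0 n)) h2.
lra.
Qed.

(** From [c n >= 7/13 y^n] and [z = rho y] with [rho = 1 - r / 2], the transient [h z^n / c n] is at
    most [13/7 h rho^n]. *)
Lemma momentum_decay (R : realFieldType) (D r eps h : R) (P Q : nat -> R) :
  0 < r -> r < 1 -> D * (1 - r ^+ 2) = 2 * r ^+ 2 ->
  0 < eps -> eps <= 1 -> 0 <= h ->
  (forall n, 0 <= P n) -> (forall n, 0 <= Q n) ->
  (1 + 15 / 32 * D) * P 0%N <= P 1%N ->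
  (forall n, (2 + 15 / 16 * D) * P n.+1 - P n <= P n.+2) ->
  Q 0%N <= h * P 0%N ->
  (forall n, Q n <= Q 0%N + \sum_(0 <= s < n)
     (n - s)%:R * (D / 32 * eps * (P s + Q s))) ->
  forall n, Q n <= (eps / 14 + 13 / 7 * h * (1 - 2^-1 * r) ^+ n) * P n.
Proof.
move=> r0 r1 hD e0 e1 h0 P0 Q0 hP1 hP hQ0 hQ n.
have D0 : 0 < D.
  have r2 : 0 < 1 - r ^+ 2 by nra.
  by rewrite -(pmulr_lgt0 _ r2) hD; nra.
have [z [y [eta [hyz [z1 hz] [y1 hy] [eta0 heta] h1]]]] := rate_choice r0 r1 hD.
have := gronwall_lucas D0 e0 e1 h0 z1 hz P0 Q0 hP1 hP hQ0 hQ n.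
have := lucas_exp_lower (ltW D0) y1 hy eta0 heta h1 n.
have : 0 < lucas (2 + 15 / 16 * D) (1 + 15 / 32 * D) n.
  by apply: (lucas_gt0 _ _ n).1; lra.
set c := lucas _ _ n => c0 hc hQn.
rewrite -(ler_pM2r c0); apply: le_trans hQn _.
rewrite [leRHS]mulrAC; apply: ler_wpM2r => //.
rewrite -hyz exprMn mulrDl lerD2l.
have rn : 0 <= (1 - 2^-1 * r) ^+ n by apply: exprn_ge0; lra.
have := ler_wpM2l (mulr_ge0 h0 rn) hc.
lra.
Qed.

(** * Euclidean norm, operator norm and least singular value *)

Lemma vnorm_ge0 {R : realType} n (x : 'cV[R]_n) : 0 <= vnorm x.
Proof. exact: sqrtr_ge0. Qed.

Lemma sqr_vnorm {R : realType} n (x : 'cV[R]_n) : vnorm x ^+ 2 = \sum_i x i 0 ^+ 2.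
Proof. by rewrite sqr_sqrtr // sumr_ge0 // => i _; exact: sqr_ge0. Qed.

Lemma sqr_vnorm_mx {R : realType} n (x : 'cV[R]_n) : vnorm x ^+ 2 = (x^T *m x) 0 0.
Proof. by rewrite sqr_vnorm mxE; apply: eq_bigr => i _; rewrite mxE expr2. Qed.

Lemma le_vnorm {R : realType} n (x y : 'cV[R]_n) :
  (forall i, `|x i 0| <= `|y i 0|) -> vnorm x <= vnorm y.
Proof.
move=> h; apply: ler_wsqrtr; apply: ler_sum => i _.
by rewrite -[leLHS]real_normK ?num_real // -[leRHS]real_normK ?num_real // lerXn2r ?nnegrE.
Qed.

Lemma vnormZ {R : realType} n a (x : 'cV[R]_n) : vnorm (a *: x) = `|a| * vnorm x.
Proof.
rewrite /vnorm -sqrtr_sqr -sqrtrM ?sqr_ge0 // mulr_sumr; congr Num.sqrt.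
by apply: eq_bigr => i _; rewrite mxE exprMn.
Qed.

Lemma vnormN {R : realType} n (x : 'cV[R]_n) : vnorm (- x) = vnorm x.
Proof. by rewrite -scaleN1r vnormZ normrN1 mul1r. Qed.

Lemma vnorm_eq0 {R : realType} n (x : 'cV[R]_n) : vnorm x = 0 -> x = 0.
Proof.
move=> x0; apply/matrixP => i j; rewrite mxE (ord1 j).
have : vnorm x ^+ 2 = 0 by rewrite x0 expr0n.
rewrite sqr_vnorm => /eqP; rewrite psumr_eq0; last by move=> ? _; exact: sqr_ge0.
by move=> /allP /(_ i); rewrite mem_index_enum sqrf_eq0 => /(_ isT) /eqP.
Qed.

Lemma vnorm0 {R : realType} n : vnorm (0 : 'cV[R]_n) = 0.
Proof. by rewrite -(scale0r 0) vnormZ normr0 mul0r. Qed.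

Lemma vnormD {R : realType} n (x y : 'cV[R]_n) : vnorm (x + y) <= vnorm x + vnorm y.
Proof.
have [x0|x0] := eqVneq (vnorm x) 0.
  by rewrite (vnorm_eq0 x0) add0r vnorm0 add0r.
have [y0|y0] := eqVneq (vnorm y) 0.
  by rewrite (vnorm_eq0 y0) addr0 vnorm0 addr0.
have px : 0 < vnorm x by rewrite lt_def x0 vnorm_ge0.
have py : 0 < vnorm y by rewrite lt_def y0 vnorm_ge0.
set a := vnorm x in px *; set b := vnorm y in py *.
have CS : \sum_i x i 0 * y i 0 <= a * b.
  rewrite -(ler_pM2l (mulr_gt0 px py)).
  have : 0 <= \sum_i (b * x i 0 - a * y i 0) ^+ 2.
    by apply: sumr_ge0 => i _; exact: sqr_ge0.
  under eq_bigr => i _.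
    rewrite (_ : _ ^+ 2 = b ^+ 2 * x i 0 ^+ 2 + a ^+ 2 * y i 0 ^+ 2
      - 2 * (a * b) * (x i 0 * y i 0)); last by ring.
    over.
  rewrite sumrB big_split /= -!mulr_sumr -!sqr_vnorm -/a -/b.
  set s := \sum_i _; lra.
rewrite -(@ler_pXn2r _ 2) ?nnegrE ?vnorm_ge0 ?addr_ge0 ?(ltW px) ?(ltW py) //.
rewrite sqr_vnorm.
under eq_bigr => i _.
  rewrite mxE (_ : _ ^+ 2 = x i 0 ^+ 2 + y i 0 ^+ 2 + 2 * (x i 0 * y i 0)); last by ring.
  over.
rewrite !big_split /= -mulr_sumr -!sqr_vnorm -/a -/b.
move: CS; set s := \sum_i _; lra.
Qed.

Lemma vnorm_sum {R : realType} n (F : nat -> 'cV[R]_n) k :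
  vnorm (\sum_(0 <= s < k) F s) <= \sum_(0 <= s < k) vnorm (F s).
Proof.
elim: k => [|k IH]; first by rewrite !big_geq // vnorm0.
rewrite !big_nat_recr //=; apply: le_trans (vnormD _ _) _; exact: lerD.
Qed.

Lemma vnorm_coord {R : realType} n (x : 'cV[R]_n) i : `|x i 0| <= vnorm x.
Proof.
rewrite -(@ler_pXn2r _ 2) ?nnegrE ?vnorm_ge0 // real_normK ?num_real // sqr_vnorm.
rewrite (bigD1 i) //= lerDl sumr_ge0 // => j _; exact: sqr_ge0.
Qed.

Lemma vnorm_normalize {R : realType} n (x : 'cV[R]_n) : vnorm x != 0 ->
  vnorm ((vnorm x)^-1 *: x) = 1.
Proof.
by move=> x0; rewrite vnormZ normfV ger0_norm ?vnorm_ge0 // mulVf.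
Qed.

Lemma opnorm_ge {R : realType} p q (M : 'M[R]_(p, q)) (x : 'cV[R]_q) :
  vnorm (M *m x) <= opnorm M * vnorm x.
Proof.
have [x0|x0] := eqVneq (vnorm x) 0.
  by rewrite (vnorm_eq0 x0) mulmx0 !vnorm0 mulr0.
have px : 0 < vnorm x by rewrite lt_def x0 vnorm_ge0.
rewrite -ler_pdivrMr // mulrC.
have -> : (vnorm x)^-1 * vnorm (M *m x) = vnorm (M *m ((vnorm x)^-1 *: x)).
  by rewrite -scalemxAr vnormZ ger0_norm // invr_ge0 vnorm_ge0.
apply: ub_le_sup; last by exists ((vnorm x)^-1 *: x) => //; exact: vnorm_normalize.
(* [sup] dominates only bounded sets. Entries of a unit vector are at most 1 in absolute value, so
   the absolute row sums provide a bound. *)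
exists (vnorm (\col_i \sum_j `|M i j|)) => _ [u u1 <-].
apply: le_vnorm => i; rewrite !mxE [leRHS]ger0_norm; last by apply: sumr_ge0.
apply: le_trans (ler_norm_sum _ _ _) _; apply: ler_sum => j _.
by rewrite normrM ler_piMr // -u1 vnorm_coord.
Qed.

Lemma sigma_min_le {R : realType} n (M : 'M[R]_n) (x : 'cV[R]_n) :
  sigma_min M * vnorm x <= vnorm (M *m x).
Proof.
have [x0|x0] := eqVneq (vnorm x) 0.
  by rewrite (vnorm_eq0 x0) mulmx0 !vnorm0 mulr0.
have px : 0 < vnorm x by rewrite lt_def x0 vnorm_ge0.
rewrite -ler_pdivlMr // mulrC.
have -> : (vnorm x)^-1 * vnorm (M *m x) = vnorm (M *m ((vnorm x)^-1 *: x)).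
  by rewrite -scalemxAr vnormZ ger0_norm // invr_ge0 vnorm_ge0.
apply: ge_inf; last by exists ((vnorm x)^-1 *: x) => //; exact: vnorm_normalize.
by exists 0 => _ [u _ <-]; exact: vnorm_ge0.
Qed.

Lemma exists_unit_vector {R : realType} n : (0 < n)%N ->
  exists x : 'cV[R]_n, vnorm x = 1.
Proof.
case: n => // n _; exists (delta_mx 0 0).
rewrite /vnorm (bigD1 0) //= big1 => [|i i0]; first by rewrite mxE !eqxx expr1n addr0 sqrtr1.
by rewrite mxE (negPf i0) expr0n.
Qed.

(** For [n = 0] there is no unit vector and [inf] takes a default value; hence [0 < n]. *)
Lemma le_sigma_min {R : realType} n (M : 'M[R]_n) a : (0 < n)%N ->
  (forall x : 'cV[R]_n, vnorm x = 1 -> a <= vnorm (M *m x)) -> a <= sigma_min M.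
Proof.
move=> n0 h; apply: lb_le_inf; last by move=> _ [x x1 <-]; exact: h.
have [x x1] := @exists_unit_vector R n n0.
by exists (vnorm (M *m x)); exists x.
Qed.


(** * Principal angles from the cosine and sine blocks *)

(* [C] and [S] are the cosine and sine blocks [U_k^T X] and [U_{-k}^T X]. *)
Lemma sigma_min_itv {R : realType} k m (C : 'M[R]_k) (S : 'M[R]_(m, k)) :
  (0 < k)%N ->
  (forall x : 'cV[R]_k, vnorm (C *m x) ^+ 2 + vnorm (S *m x) ^+ 2 = vnorm x ^+ 2) ->
  0 <= sigma_min C <= 1.
Proof.
move=> k0 hCS; apply/andP; split.
  by apply: le_sigma_min => // x _; exact: vnorm_ge0.
have [x x1] := @exists_unit_vector R k k0.
have := sigma_min_le C x; rewrite x1 mulr1 => /le_trans; apply.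
rewrite -(@ler_pXn2r _ 2) ?nnegrE ?vnorm_ge0 // expr1n.
by have := hCS x; rewrite x1 expr1n => <-; rewrite lerDl sqr_ge0.
Qed.

(** On unit vectors [|C x| <= 1], so [|C x|^2 = 1 - |S x|^2 >= 1 - eps^2], which bounds the squared
    cosine below. *)
Lemma sin_acos_sigma_min_le {R : realType} k m (C : 'M[R]_k) (S : 'M[R]_(m, k)) eps :
  (0 < k)%N -> 0 <= eps -> eps <= 1 ->
  (forall x : 'cV[R]_k, vnorm (C *m x) ^+ 2 + vnorm (S *m x) ^+ 2 = vnorm x ^+ 2) ->
  (forall x : 'cV[R]_k, vnorm (S *m x) <= eps * vnorm (C *m x)) ->
  sin (acos (sigma_min C)) <= eps.
Proof.
move=> k0 e0 e1 hCS hS.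
have /andP[s0 s1] := sigma_min_itv k0 hCS.
rewrite sin_acos; last by rewrite s1 andbT; lra.
rewrite -[leRHS](ger0_norm e0) -sqrtr_sqr; apply: ler_wsqrtr.
have h : Num.sqrt (1 - eps ^+ 2) <= sigma_min C.
  apply: le_sigma_min => // x x1.
  rewrite -[leRHS]ger0_norm ?vnorm_ge0 // -sqrtr_sqr; apply: ler_wsqrtr.
  have := hCS x; rewrite x1 expr1n; have := hS x.
  have := vnorm_ge0 (S *m x); have := vnorm_ge0 (C *m x).
  set c := vnorm (C *m x); set s := vnorm _ => c0 ss0 hs hcs.
  have c1 : c ^+ 2 <= 1 by rewrite -hcs lerDl sqr_ge0.
  have : s ^+ 2 <= eps ^+ 2 * c ^+ 2 by rewrite -exprMn lerXn2r ?nnegrE ?mulr_ge0.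
  have := ler_wpM2l (sqr_ge0 eps) c1.
  lra.
have : Num.sqrt (1 - eps ^+ 2) ^+ 2 <= sigma_min C ^+ 2.
  by rewrite lerXn2r ?nnegrE ?sqrtr_ge0.
rewrite sqr_sqrtr; first lra.
nra.
Qed.

(** Squaring and the Pythagorean identity reduce this to [sigma_min C * |x| <= |C x|]. *)
Lemma vnorm_le_tan {R : realType} k m (C : 'M[R]_k) (S : 'M[R]_(m, k)) (x : 'cV[R]_k) :
  (0 < k)%N ->
  (forall x : 'cV[R]_k, vnorm (C *m x) ^+ 2 + vnorm (S *m x) ^+ 2 = vnorm x ^+ 2) ->
  0 < sigma_min C ->
  vnorm (S *m x) <= tan (acos (sigma_min C)) * vnorm (C *m x).
Proof.
move=> k0 hCS sp.
have /andP[s0 s1] := sigma_min_itv k0 hCS.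
rewrite /tan acosK; last by rewrite in_itv /= s1 andbT; lra.
rewrite sin_acos; last by rewrite s1 andbT; lra.
rewrite mulrAC ler_pdivlMr //.
have h := sigma_min_le C x.
have h1 := hCS x.
move: h h1 (vnorm_ge0 x) (vnorm_ge0 (S *m x)) (vnorm_ge0 (C *m x)).
set s := sigma_min C in sp s0 s1 *.
set c := vnorm (C *m x); set v := vnorm x; set w := vnorm _ => h h1 v0 w0 c0.
have t0 : 0 <= 1 - s ^+ 2 by nra.
rewrite -(@ler_pXn2r _ 2) ?nnegrE ?mulr_ge0 ?sqrtr_ge0 //.
rewrite !exprMn (sqr_sqrtr t0).
have h2 : (s * v) ^+ 2 <= c ^+ 2 by rewrite lerXn2r ?nnegrE ?mulr_ge0.
rewrite exprMn -h1 in h2.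
lra.
Qed.

(** * Momentum recurrences in the eigenbasis *)

(** Dividing by [b^n] turns the coefficient [b^2] into 1, [L] into [2 + D], and moves [nu] into
    [0, 2], inside the Chebyshev range. *)
Lemma momentum_vectors {R : realType} k m (b L eps h : R) (mu : 'rV[R]_k)
    (nu : 'rV[R]_m) (p e : nat -> 'cV[R]_k) (q f : nat -> 'cV[R]_m) :
  0 < b -> 2 * b < L -> 0 < eps -> eps <= 1 -> 0 <= h ->
  (forall i, L <= mu 0 i) -> (forall j, 0 <= nu 0 j <= 2 * b) ->
  p 1%N = 2^-1 *: (diag_mx mu *m p 0%N) + e 0%N ->
  q 1%N = 2^-1 *: (diag_mx nu *m q 0%N) + f 0%N ->
  (forall n, p n.+2 = diag_mx mu *m p n.+1 - b ^+ 2 *: p n + e n.+1) ->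
  (forall n, q n.+2 = diag_mx nu *m q n.+1 - b ^+ 2 *: q n + f n.+1) ->
  (forall n, vnorm (e n) <= 32^-1 * (L - 2 * b) * vnorm (p n)) ->
  (forall n, vnorm (f n) <= 32^-1 * (L - 2 * b) * eps * (vnorm (p n) + vnorm (q n))) ->
  vnorm (q 0%N) <= h * vnorm (p 0%N) ->
  forall n, vnorm (q n) <=
    (eps / 14 + 13 / 7 * h * (1 - 2^-1 * Num.sqrt ((L - 2 * b) / L)) ^+ n) * vnorm (p n).
Proof.
move=> b0 bL eps0 eps1 h0 hmu hnu p1 q1 pS qS he hf hq0 n.
have L0 : 0 < L by lra.
have bn s : 0 < b ^+ s by apply: exprn_gt0.
pose D := (L - 2 * b) / b.
have DE : D * b = L - 2 * b by rewrite /D divfK // gt_eqF.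
have hmup v : L * vnorm v <= vnorm (diag_mx mu *m v).
  rewrite -{1}(ger0_norm (ltW L0)) -vnormZ; apply: le_vnorm => i.
  rewrite mul_diag_mx !mxE !normrM ler_wpM2r // (ger0_norm (ltW L0)).
  by apply: le_trans (ler_norm _).
rewrite -(@ler_pM2r _ (b ^+ n)^-1) ?invr_gt0 // -[leRHS]mulrA.
pose P s := vnorm (p s) / b ^+ s; pose Q s := vnorm (q s) / b ^+ s.
have PE s : vnorm (p s) = P s * b ^+ s by rewrite divfK // gt_eqF.
have QE s : vnorm (q s) = Q s * b ^+ s by rewrite divfK // gt_eqF.
apply: (@momentum_decay _ D _ _ _ P Q) => //.
- by rewrite sqrtr_gt0 divr_gt0 // subr_gt0.
- rewrite -[ltRHS]sqrtr1 ltr_sqrt // ltr_pdivrMr //; lra.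
- rewrite sqr_sqrtr; last by rewrite divr_ge0; lra.
  by rewrite /D; field; rewrite !gt_eqF.
- by move=> s; rewrite divr_ge0 ?vnorm_ge0 // ltW.
- by move=> s; rewrite divr_ge0 ?vnorm_ge0 // ltW.
(* The noise costs [D / 32]. The halved first step leaves exactly [1 + D/2 - D/32 = 1 + 15/32 D];
   later steps leave [2 + 31/32 D], above [2 + 15/16 D]. *)
- have h1 := hmup (p 0%N).
  have h2 : vnorm (diag_mx mu *m p 0%N) <= 2 * (vnorm (p 1%N) + vnorm (e 0%N)).
    have -> : diag_mx mu *m p 0%N = 2 *: (p 1%N - e 0%N).
      by rewrite p1 addrK scalerA divff ?pnatr_eq0 // scale1r.
    rewrite vnormZ ger0_norm // ler_pM2l //.
    by apply: le_trans (vnormD _ _) _; rewrite vnormN.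
  have h3 := he 0%N.
  rewrite !PE expr0 expr1 mulr1 -DE in h1 h2 h3.
  rewrite -(ler_pM2r b0).
  have LE : L = (2 + D) * b by lra.
  rewrite LE in h1; lra.
- move=> s.
  have h1 := hmup (p s.+1).
  have h2 : vnorm (diag_mx mu *m p s.+1) <=
      vnorm (p s.+2) + b ^+ 2 * vnorm (p s) + vnorm (e s.+1).
    have -> : diag_mx mu *m p s.+1 = p s.+2 + b ^+ 2 *: p s - e s.+1.
      by rewrite pS; apply/matrixP => i j; rewrite !mxE; ring.
    apply: le_trans (vnormD _ _) _; rewrite vnormN lerD2r.
    by apply: le_trans (vnormD _ _) _; rewrite vnormZ (ger0_norm (sqr_ge0 _)).
  have h3 := he s.+1.
  rewrite !PE -DE in h1 h2 h3.
  have LE : L = (2 + D) * b by lra.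
  rewrite LE in h1.
  rewrite -(ler_pM2r (bn s.+2)).
  have := vnorm_ge0 (p s.+1); rewrite PE => P1.
  have : 0 <= D * b * (P s.+1 * b ^+ s.+1) by rewrite mulr_ge0 // DE; lra.
  rewrite !exprS in h1 h2 h3 *.
  lra.
- by rewrite /P /Q !expr0 !divr1.
- move=> {}n.
  pose x j := nu 0 j / b.
  have hx j : `|x j| <= 2.
    have /andP[? ?] := hnu j.
    rewrite ger0_norm ?divr_ge0 ?(ltW b0) // ler_pdivrMr //.
  have duh j := @lucas_duhamel _ (x j) (x j / 2)
     (fun s => q s j 0 / b ^+ s) (fun s => f s j 0 / b ^+ s.+1).
  have -> : Q n = vnorm ((b ^+ n)^-1 *: q n).
    by rewrite vnormZ ger0_norm ?invr_ge0 ?(ltW (bn _)) // mulrC.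
  (* The block is diagonal, so Duhamel's formula applies to each coordinate. The factor 1/2 in the
     first step makes the homogeneous solution [T_n], which stays bounded by 1. *)
  have -> : (b ^+ n)^-1 *: q n = \col_j (lucas (x j) (x j / 2) n * q 0%N j 0)
     + \sum_(0 <= s < n) (\col_j (lucas (x j) (x j) (n - s.+1) * (f s j 0 / b ^+ s.+1))).
    apply/matrixP => j i; rewrite (ord1 i) !mxE summxE mulrC duh.
    - rewrite expr0 divr1; congr (_ + _).
      by apply: eq_bigr => s _; rewrite mxE.
    - rewrite q1 mul_diag_mx !mxE expr0 expr1 /x; field.
      by rewrite gt_eqF.
    - move=> s; rewrite qS mul_diag_mx !mxE !exprS /x; field.
      by rewrite !gt_eqF.
  apply: le_trans (vnormD _ _) _; apply: lerD.
    rewrite /Q expr0 divr1; apply: le_vnorm => j.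
    by rewrite mxE normrM ler_piMl // cheb1_le1.
  apply: le_trans (vnorm_sum _ _) _; apply: ler_sum_nat => s /andP[_ sn].
  apply: (@le_trans _ _ (vnorm (((n - s)%:R / b ^+ s.+1) *: f s))).
    apply: le_vnorm => j; rewrite !mxE !normrM.
    have := cheb2_le (n - s.+1) (hx j).
    rewrite (_ : (n - s.+1).+1 = n - s)%N; last by rewrite subnSK.
    move=> hc; rewrite (mulrC `|f s j 0|) mulrA ler_wpM2r // ler_wpM2r //.
    by rewrite [leRHS]ger0_norm.
  rewrite vnormZ ger0_norm; last by rewrite divr_ge0 // ltW.
  rewrite -[leLHS]mulrA; apply: ler_wpM2l => //.
  rewrite mulrC ler_pdivrMr //.
  apply: le_trans (hf s) _.
  by rewrite -DE PE QE exprS le_eqVlt; apply/orP; left; apply/eqP; ring.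
Qed.

(** * Hitting time, eigenblocks and orbits of the triangular factors *)

Lemma geometric_hitting_time {R : realType} (a rho : R) (t : nat) :
  0 <= a -> 0 < rho -> rho < 1 -> ln a / (- ln rho) <= t%:R -> a * rho ^+ t <= 1.
Proof.
move=> a0 r0 r1 hT.
(* The case [a = 0] arises when the initial tangent vanishes; [ln a] is then only a default
   value. *)
have [->|an0] := eqVneq a 0; first by rewrite mul0r.
have ap : 0 < a by rewrite lt_def an0.
have rt : 0 < rho ^+ t by exact: exprn_gt0.
have l0 : 0 < - ln rho by rewrite oppr_gt0 ln_lt0 // r0.
rewrite -ler_ln ?posrE ?mulr_gt0 // ln1 lnM ?posrE // lnXn //.
move: hT; rewrite ler_pdivrMr // -mulr_natl; lra.
Qed.

Lemma eigenblock_mul {R : realType} k m (A U : 'M[R]_(k + m)) (l : 'rV[R]_(k + m)) :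
  U^T *m U = 1%:M -> A = U *m diag_mx l *m U^T ->
  (lsubmx U)^T *m A = diag_mx (lsubmx l) *m (lsubmx U)^T /\
  (rsubmx U)^T *m A = diag_mx (rsubmx l) *m (rsubmx U)^T.
Proof.
move=> hU ->.
have : U^T *m (U *m diag_mx l *m U^T) = diag_mx l *m U^T.
  by rewrite !mulmxA hU mul1mx.
set B := U *m _ *m _.
rewrite -[in diag_mx l](hsubmxK l) diag_mx_row -{1 2}(hsubmxK U) tr_row_mx.
rewrite mul_col_mx mul_block_col !mul0mx addr0 add0r.
by move=> /eq_col_mx.
Qed.

(** [U] is square, so [U^T U = 1] also gives [U U^T = 1]: the two block projectors sum to the
    identity. *)
Lemma stiefel_pythagoras {R : realType} k m n (U : 'M[R]_(k + m))
    (X : 'M[R]_(k + m, n)) (x : 'cV[R]_n) :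
  U^T *m U = 1%:M -> stiefel X ->
  vnorm ((lsubmx U)^T *m X *m x) ^+ 2 + vnorm ((rsubmx U)^T *m X *m x) ^+ 2
    = vnorm x ^+ 2.
Proof.
move=> hU hX.
have E : lsubmx U *m (lsubmx U)^T + rsubmx U *m (rsubmx U)^T = 1%:M.
  by rewrite -mul_row_col -tr_row_mx hsubmxK; apply: mulmx1C.
rewrite !sqr_vnorm_mx !trmx_mul !trmxK.
suff /matrixP/(_ 0 0) <- : x^T *m (X^T *m (lsubmx U *m (lsubmx U)^T) *m X) *m x
    + x^T *m (X^T *m (rsubmx U *m (rsubmx U)^T) *m X) *m x = x^T *m x.
  by rewrite [RHS]mxE !mulmxA.
by rewrite -mulmxDl -mulmxDr -mulmxDl -mulmxDr E mulmx1 hX mulmx1.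
Qed.

(** Backwards from time [t] the orbit is obtained by inverting the factors, forwards by applying
    them. *)
Lemma unit_orbit {R : realType} k (Rm : nat -> 'M[R]_k) (x : 'cV[R]_k) (t : nat) :
  (forall s, Rm s.+1 \in unitmx) ->
  exists v : nat -> 'cV[R]_k, v t = x /\ forall s, v s.+1 = Rm s.+1 *m v s.
Proof.
move=> hR; elim: t x => [|t IH] x.
  by exists (fix v s := if s is s'.+1 then Rm s'.+1 *m v s' else x).
have [v [vt vS]] := IH (invmx (Rm t.+1) *m x).
by exists v; split => //; rewrite vS vt mulKVmx.
Qed.

Unset Implicit Arguments.
(* d = k + m with k >= 1, m >= 1 (i.e. d > k >= 1).
   U : orthogonal matrix of eigenvectors, lam : eigenvalues (0-based index),
   U_k = lsubmx U, U_{-k} = rsubmx U, lambda_k = lam k.-1,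
   lambda_{k+1} = lam k. *)
Theorem theorem1 (R : realType) (k m : nat) (hk : (1 <= k)%N) (hm : (1 <= m)%N)
  (eps : R) (heps0 : 0 < eps) (heps1 : eps < 1)
  (A : 'M[R]_(k + m)) (U : 'M[R]_(k + m)) (lam : nat -> R)
  (hAsym : A^T = A)
  (hU : U^T *m U = 1%:M)
  (hAdec : A = U *m diag_mx (\row_i lam i) *m U^T)
  (hlam_nonneg : forall i : 'I_(k + m), 0 <= lam i)
  (hlam_sorted : forall i j : 'I_(k + m), (i <= j)%N -> lam j <= lam i)
  (hgap : lam k.-1 > lam k)
  (beta : R) (hbeta : 0 < beta)
  (hbeta1 : lam k.-1 > 2 * Num.sqrt beta)
  (hbeta2 : 2 * Num.sqrt beta >= lam k)
  (X : nat -> 'M[R]_(k + m, k)) (Rm : nat -> 'M[R]_k)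
  (Xi : nat -> 'M[R]_(k + m, k))
  (hX0 : stiefel (X 0%N))
  (hcos0 : cos (theta_k (lsubmx U) (X 0%N)) > 0)
  (hQR1 : is_QR (2^-1 *: (A *m X 0%N) + Xi 0%N) (X 1%N) (Rm 1%N))
  (hQR : forall t : nat, (1 <= t)%N ->
     is_QR (A *m X t - beta *: (X t.-1 *m invmx (Rm t)) + Xi t)
           (X t.+1) (Rm t.+1))
  (hRinv : forall t : nat, (1 <= t)%N -> Rm t \in unitmx)
  (hXi_perp : forall t : nat,
     opnorm ((rsubmx U)^T *m Xi t)
       <= 32^-1 * (lam k.-1 - 2 * Num.sqrt beta) * eps)
  (hXi_par : forall t : nat,
     opnorm ((lsubmx U)^T *m Xi t)
       <= 32^-1 * (lam k.-1 - 2 * Num.sqrt beta)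
          * cos (theta_k (lsubmx U) (X t))) :
  let h0 := tan (theta_k (lsubmx U) (X 0%N)) in
  let T := ln (2 * h0 / eps) /
           (- ln (1 - 2^-1 * Num.sqrt ((lam k.-1 - 2 * Num.sqrt beta)
                                        / lam k.-1))) in
  forall t : nat, T <= t%:R -> sin (theta_k (lsubmx U) (X t)) <= eps.
Proof.
move=> h0 T t hT.
set b := Num.sqrt beta in hbeta1 hbeta2 hXi_perp hXi_par T hT.
have b0 : 0 < b by rewrite sqrtr_gt0.
have bE : b ^+ 2 = beta by rewrite sqr_sqrtr // ltW.
set L := lam k.-1 in hgap hbeta1 hXi_perp hXi_par T hT.
have hX s : stiefel (X s).
  case: s => [//|[|s]]; first by case: hQR1.
  by case: (hQR s.+1 isT).
pose C s := (lsubmx U)^T *m X s; pose S s := (rsubmx U)^T *m X s.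
have hCS s (x : 'cV[R]_k) : vnorm (C s *m x) ^+ 2 + vnorm (S s *m x) ^+ 2 = vnorm x ^+ 2.
  exact: stiefel_pythagoras.
have itv s := sigma_min_itv hk (hCS s).
have cosE s : cos (theta_k (lsubmx U) (X s)) = sigma_min (C s).
  by apply: acosK; rewrite in_itv /=; have /andP[? ?] := itv s; lra.
rewrite cosE in hcos0.
apply: (sin_acos_sigma_min_le hk (ltW heps0) (ltW heps1) (hCS t)) => x.
have hRu s : Rm s.+1 \in unitmx by exact: hRinv.
have [v [<- vS]] := unit_orbit x t hRu.
have vK s : invmx (Rm s.+1) *m v s.+1 = v s by rewrite vS mulKmx.
have h0ge : 0 <= h0.
  rewrite /h0 /tan cosE divr_ge0 //; last by have /andP[] := itv 0%N.
  rewrite /theta_k sin_acos ?sqrtr_ge0 //.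
  by have /andP[] := itv 0%N; rewrite -/(C 0%N); lra.
pose l := \row_i lam (nat_of_ord i) : 'rV[R]_(k + m).
have [eigC eigS] := eigenblock_mul (l := l) hU hAdec.
pose e s := (lsubmx U)^T *m Xi s *m v s.
pose f s := (rsubmx U)^T *m Xi s *m v s.
have X1 : X 1%N *m v 1%N = 2^-1 *: (A *m X 0%N *m v 0%N) + Xi 0%N *m v 0%N.
  by case: hQR1 => h _ _ _; rewrite vS mulmxA -h mulmxDl -scalemxAl.
(* The factor [invmx (Rm s.+1)] sends [v s.+1] back to [v s], so the memory term becomes
   [X s *m v s]. *)
have XS s : X s.+2 *m v s.+2 = A *m X s.+1 *m v s.+1 - beta *: (X s *m v s)
    + Xi s.+1 *m v s.+1.
  case: (hQR s.+1 isT) => h _ _ _; rewrite [v s.+2]vS mulmxA -h /=.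
  by rewrite mulmxDl mulmxBl -scalemxAl -(mulmxA (X s)) vK.
have gen (n : nat) (W : 'M[R]_(n, k + m)) (g : 'rV[R]_n) : W *m A = diag_mx g *m W ->
  W *m X 1%N *m v 1%N = 2^-1 *: (diag_mx g *m (W *m X 0%N *m v 0%N)) + W *m Xi 0%N *m v 0%N
  /\ forall s, W *m X s.+2 *m v s.+2 = diag_mx g *m (W *m X s.+1 *m v s.+1)
     - b ^+ 2 *: (W *m X s *m v s) + W *m Xi s.+1 *m v s.+1.
  move=> hW; split=> [|s].
    by rewrite -mulmxA X1 mulmxDr -scalemxAr !mulmxA hW.
  by rewrite -mulmxA XS mulmxDr mulmxBr -scalemxAr !mulmxA hW bE.
have [p1 pS] := gen _ _ _ eigC; have [q1 qS] := gen _ _ _ eigS.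
have gap0 : 0 <= 32^-1 * (L - 2 * b) by lra.
(* The cosine in the noise bound is [sigma_min (C s)], and its product with [|v s|] is at most
   [|C s v s|]: the noise is small relative to [p]. *)
have he s : vnorm (e s) <= 32^-1 * (L - 2 * b) * vnorm (C s *m v s).
  apply: le_trans (opnorm_ge _ _) _.
  apply: le_trans (ler_wpM2r (vnorm_ge0 _) (hXi_par s)) _.
  rewrite cosE -[leLHS]mulrA; apply: ler_wpM2l => //; exact: sigma_min_le.
(* By Pythagoras [|v s|] is at most the sum of the norms of its two blocks. *)
have hf s : vnorm (f s) <= 32^-1 * (L - 2 * b) * eps *
    (vnorm (C s *m v s) + vnorm (S s *m v s)).
  apply: le_trans (opnorm_ge _ _) _.
  apply: le_trans (ler_wpM2r (vnorm_ge0 _) (hXi_perp s)) _.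
  apply: ler_wpM2l; first by rewrite mulr_ge0 // ltW.
  rewrite -(@ler_pXn2r _ 2) ?nnegrE ?addr_ge0 ?vnorm_ge0 // -(hCS s).
  by rewrite sqrrD lerD2r lerDl mulrn_wge0 // mulr_ge0 ?vnorm_ge0.
have hmu i : L <= lsubmx l 0 i.
  rewrite !mxE /L.
  have hi : (k.-1 < k + m)%N by rewrite ltn_addr // prednK.
  apply: (hlam_sorted (lshift m i) (Ordinal hi)) => /=.
  by rewrite -ltnS prednK.
have hnu j : 0 <= rsubmx l 0 j <= 2 * b.
  rewrite !mxE hlam_nonneg /=; apply: le_trans hbeta2.
  have hi : (k < k + m)%N by rewrite -[X in (X < _)%N]addn0 ltn_add2l.
  by apply: (hlam_sorted (Ordinal hi) (rshift k j)); rewrite /= leq_addr.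
have hq0 : vnorm (S 0%N *m v 0%N) <= h0 * vnorm (C 0%N *m v 0%N).
  exact: (vnorm_le_tan _ hk (hCS 0%N) hcos0).
have := momentum_vectors b0 hbeta1 heps0 (ltW heps1) h0ge hmu hnu p1 q1 pS qS he hf hq0 t.
move=> /le_trans; apply; apply: ler_wpM2r; first exact: vnorm_ge0.
set rho := 1 - _.
have hr : 0 < Num.sqrt ((L - 2 * b) / L) < 1.
  have L0 : 0 < L by lra.
  rewrite sqrtr_gt0 divr_gt0 ?subr_gt0 //= -[ltRHS]sqrtr1 ltr_sqrt // ltr_pdivrMr //; lra.
have /andP[hr0 hr1] := hr.
have := @geometric_hitting_time R (2 * h0 / eps) rho t.
have -> : 2 * h0 / eps * rho ^+ t = 2 * (h0 * rho ^+ t) / eps by ring.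
rewrite (ler_pdivrMr _ _ heps0) mul1r => H.
(* With this the two terms add up to exactly [eps]: 1/14 + (13/7)(1/2) = 1. *)
have : 2 * (h0 * rho ^+ t) <= eps.
  apply: H => //; first by apply: divr_ge0; [exact: mulr_ge0|exact: ltW].
  - by rewrite /rho; lra.
  - by rewrite /rho; lra.
lra.
Qed.
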